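(* Let $\mathfrak{H}$ be a hereditary homomorph of finite groups. Then $v^*\mathfrak{H}$ is a solubly saturated formation. In particular, if $\mathfrak{H}$ consists of soluble groups, then $v^*\mathfrak{H}$ is a saturated formation.
   Context: All groups are finite. A homomorph is a class of groups closed under epimorphic images; hereditary means closed under subgroups. A formation is a homomorph closed under subdirect products. A formation $\mathfrak{F}$ is saturated if $G/\Phi(G)\in\mathfrak{F}$ implies $G\in\mathfrak{F}$, and solubly saturated if $G/\Phi(R(G))\in\mathfrak{F}$ implies $G\in\mathfrak{F}$, where $R(G)$ is the soluble radical of $G$. A subgroup $H$ of $G$ is $K$-$\mathfrak{H}$-subnormal in $G$ if there is a chain $H=H_0\le H_1\le\dots\le H_n=G$ such that for each $i$, either $H_{i-1}\trianglelefteq H_i$ or $H_i/\mathrm{Core}_{H_i}(H_{i-1})\in\mathfrak{H}$. $v^*\mathfrak{H}$ is the class of all groups all of whose cyclic subgroups of prime power order are $K$-$\mathfrak{H}$-subnormal. *)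

(* Defs.v *)
From mathcomp Require Import all_boot all_fingroup all_solvable.
Set Implicit Arguments. Unset Strict Implicit. Unset Printing Implicit Defensive.
Import GroupScope.

(* A class of finite groups: a predicate on (finite) groups G living in some
   finGroupType gT.  Invariance under isomorphism follows from the homomorph
   closure below. *)
Definition gclass := forall gT : finGroupType, {group gT} -> Prop.

Definition homomorph (F : gclass) : Prop :=
  forall (gT rT : finGroupType) (G : {group gT}) (f : {morphism G >-> rT}),
    F gT G -> F rT (f @* G)%G.

Definition hereditary (F : gclass) : Prop :=
  forall (gT : finGroupType) (G H : {group gT}), H \subset G -> F gT G -> F gT H.

Definition subdirect_closed (F : gclass) : Prop :=
  forall (gT : finGroupType) (G N1 N2 : {group gT}),
    N1 <| G -> N2 <| G -> N1 :&: N2 = 1 ->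
    F _ (G / N1)%G -> F _ (G / N2)%G -> F gT G.

Definition formation (F : gclass) : Prop := homomorph F /\ subdirect_closed F.

Definition saturated_formation (F : gclass) : Prop :=
  formation F /\
  forall (gT : finGroupType) (G : {group gT}), F _ (G / 'Phi(G))%G -> F gT G.

Definition sol_radical (gT : finGroupType) (G : {set gT}) : {group gT} :=
  <<\bigcup_(H : {group gT} | (H <| G) && solvable H) H>>%G.

Definition solubly_saturated_formation (F : gclass) : Prop :=
  formation F /\
  forall (gT : finGroupType) (G : {group gT}),
    F _ (G / 'Phi(sol_radical G))%G -> F gT G.

Inductive KH_subnormal (F : gclass) (gT : finGroupType) (G : {group gT})
  : {group gT} -> Prop :=
| KHsn_top : KH_subnormal F G G
| KHsn_step (H K : {group gT}) :
    KH_subnormal F G K -> H \subset K ->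
    (H <| K \/ F _ (K / gcore H K)%G) -> KH_subnormal F G H.

Definition vstar (F : gclass) : gclass :=
  fun gT G => forall (x : gT) (p : nat), x \in G -> prime p -> p.-elt x ->
    KH_subnormal F G <[x]>%G.

(* Main.v *)
Require Import Defs.
From mathcomp Require Import all_boot all_fingroup all_solvable.
From mathcomp Require Import all_algebra all_field.
Set Implicit Arguments. Unset Strict Implicit. Unset Printing Implicit Defensive.
Import GRing.Theory GroupScope.

(**
For a p-element y acting on a q-group N with q <> p, whether <y> is
K-F-subnormal in N<y> depends only on the order p^j of the automorphism induced
by y: all faithful irreducible modules of a cyclic group of order p^j over the
field with q elements give isomorphic semidirect products, and those for
smaller powers of p are sections of them. So if x acts on a q-group Q at least
as faithfully as y does on N, and <x> is K-F-subnormal in Q<x>, then <y> is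
K-F-subnormal in N<y>.

Working inside R(G)<x> reduces soluble saturation to a soluble group G and a
minimal normal q-subgroup M of G contained in the Frattini subgroup. With
S = (G/M) / O_q'(G/M) and Q = O_q(S), the image of x in S acts faithfully on Q,
while a Frattini argument makes O_q'(G/M) lift to a normal q'-subgroup
centralising M; hence x acts on Q at least as faithfully as on M.
*)

(** * Homomorphs and sections *)

(** On [K] the map [f] factors through [q], so [f @* K] is an epimorphic image of [q @* K]. This
    form moves membership in [F] between quotients without building isomorphisms. *)
Lemma homomorph_factor (F : gclass) (hF : homomorph F)
    (gT qT rT : finGroupType) (D1 D2 K : {group gT})
    (q : {morphism D1 >-> qT}) (f : {morphism D2 >-> rT}) (sKD2 : K \subset D2) :
  K \subset D1 -> 'ker_K q \subset 'ker f ->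
  F _ (q @* K)%G -> F _ (f @* K)%G.
Proof.
move=> sKD1 sker FqK.
have sk : 'ker (restrm sKD1 q) \subset 'ker (restrm sKD2 f).
  by rewrite !ker_restrm subsetI subsetIl.
have eqK : (restrm_morphism sKD1 q @* K)%G = (q @* K)%G.
  by apply: group_inj; rewrite /= morphim_restrm setIid.
rewrite -eqK in FqK.
have := hF _ _ _ (factm_morphism sk (subxx K)) FqK.
congr (F _ _); apply: group_inj => /=.
by rewrite morphim_factm morphim_restrm setIid.
Qed.

Lemma homomorph_isog (F : gclass) (gT rT : finGroupType) (G : {group gT}) (H : {group rT}) :
  homomorph F -> G \isog H -> F gT G -> F rT H.
Proof. by move=> hF /isogP[f _ /group_inj <-]; apply: hF. Qed.

Lemma homomorph_quotient (F : gclass) (gT : finGroupType) (G N : {group gT}) :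
  homomorph F -> N <| G -> F gT G -> F _ (G / N)%G.
Proof.
move=> hF /andP[_ nNG] /(hF _ _ _ (restrm_morphism nNG (coset_morphism N))).
by congr (F _ _); apply: group_inj; rewrite /= morphim_restrm setIid.
Qed.

Lemma gcore_normal (gT : finGroupType) (H K : {group gT}) :
  H \subset K -> gcore H K <| K.
Proof.
by move=> sHK; rewrite /normal gcore_norm (subset_trans (gcore_sub H K) sHK).
Qed.

(** * K-F-subnormality and the formation property of [vstar F] *)

Section KHSubnormal.

Variables (F : gclass) (hF : homomorph F) (sF : hereditary F).

Lemma KHsn_sub (gT : finGroupType) (G H : {group gT}) :
  KH_subnormal F G H -> H \subset G.
Proof. by elim=> // H1 K _ sKG sHK _; apply: subset_trans sKG. Qed.

Lemma KHsn_trans (gT : finGroupType) (G H K : {group gT}) :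
  KH_subnormal F K H -> KH_subnormal F G K -> KH_subnormal F G H.
Proof. by move=> + KG; elim=> // H1 K1 _ IH sHK; apply: KHsn_step IH sHK. Qed.

Lemma subnormal_KHsn (gT : finGroupType) (G H : {group gT}) :
  H <|<| G -> KH_subnormal F G H.
Proof.
have [n] := ubnP #|G|; elim: n G => // n IH G leGn snHG.
have [/group_inj->|[K [snHK nsKG prKG]]] := subnormalEr snHG.
  exact: KHsn_top.
have ltKn : #|K| < n by apply: leq_trans (proper_card prKG) _.
apply: KHsn_trans (IH K ltKn snHK) _.
by apply: KHsn_step (KHsn_top F G) (normal_sub nsKG) _; left.
Qed.

Lemma normal_KHsn (gT : finGroupType) (G H : {group gT}) :
  H <| G -> KH_subnormal F G H.
Proof. by move=> nsHG; apply: subnormal_KHsn (normal_subnormal nsHG). Qed.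

(** For a step with [K / C] in [F], the group [C :&: L] lies in the new core, so the new core
    quotient is an epimorphic image of a subgroup of [K / C]. *)
Lemma KHsn_setI (gT : finGroupType) (G H L : {group gT}) :
  L \subset G -> KH_subnormal F G H -> KH_subnormal F L (H :&: L)%G.
Proof.
move=> sLG; elim=> [|H1 K _ IH sHK step].
  by have -> : (G :&: L)%G = L by [apply: group_inj; apply/setIidPr]; apply: KHsn_top.
apply: KHsn_step IH _ _; first exact: setSI.
case: step => [nsHK | FKc].
  left; rewrite /normal setSI //= normsI ?normG //.
    by rewrite (subset_trans (subsetIl _ _) (normal_norm nsHK)).
  by rewrite (subset_trans (subsetIr _ _) (normG _)).
right; set C := gcore _ K in FKc.
have nCK : K \subset 'N(C) by apply: gcore_norm.
have sKLK : (K :&: L)%G \subset K by apply: subsetIl.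
apply: (homomorph_factor hF (q := coset C)); rewrite /= ?gcore_norm //.
- exact: subset_trans sKLK nCK.
- rewrite !ker_coset; apply: gcore_max.
    rewrite subsetI (subset_trans (subsetIr _ _) (gcore_sub _ _)).
    by rewrite (subset_trans (subsetIl _ _) (subsetIr _ _)).
  by rewrite normsI ?normG // (subset_trans sKLK).
- by apply: sF FKc; rewrite /= morphimS.
Qed.

(** The image of a core is normal in the image of [K], hence lies in the new core; the new core
    quotient is thus an image of the old one. *)
Lemma KHsn_morphim (gT rT : finGroupType) (D G H : {group gT})
    (f : {morphism D >-> rT}) :
  G \subset D -> KH_subnormal F G H -> KH_subnormal F (f @* G)%G (f @* H)%G.
Proof.
move=> sGD; elim=> [|H1 K sn IH sHK step]; first exact: KHsn_top.
apply: KHsn_step IH _ _; first exact: morphimS.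
have sKD : K \subset D by apply: subset_trans (KHsn_sub sn) sGD.
case: step => [nsHK | FKc]; first by left; apply: morphim_normal.
right; set C := gcore H1 K in FKc; set C' := gcore _ _.
have nCK : K \subset 'N(C) by apply: gcore_norm.
have nC'K : f @* K \subset 'N(C') by apply: gcore_norm.
have sK : K \subset f @*^-1 'N(C') by rewrite -sub_morphim_pre.
have := @homomorph_factor _ hF _ _ _ _ _ K (coset_morphism C)
  (comp_morphism f (coset_morphism C')) sK nCK _ FKc.
rewrite /= (_ : (_ @* K)%G = (f @* K / C')%G); last first.
  by apply: group_inj; rewrite /= morphim_comp.
apply; rewrite ker_comp !ker_coset -sub_morphim_pre; last first.
  by rewrite subIset // sKD.
apply: gcore_max; first by rewrite morphimS // (subset_trans (subsetIr _ _)) ?gcore_sub.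
by rewrite (subset_trans _ (morphim_norm _ _)) // morphimS // normsI ?normG.
Qed.

Lemma KHsn_cosetpre (gT : finGroupType) (G N : {group gT})
    (H : {group coset_of N}) :
  N <| G -> KH_subnormal F (G / N)%G H -> KH_subnormal F G (coset N @*^-1 H)%G.
Proof.
move=> nsNG; elim=> [|H1 K sn IH sHK step].
  by have -> : (coset N @*^-1 (G / N))%G = G;
    [apply: group_inj; rewrite /= quotientGK | apply: KHsn_top].
apply: KHsn_step IH _ _; first exact: morphpreS.
case: step => [nsHK | FKc]; first by left; rewrite cosetpre_normal.
right; set C := gcore H1 K in FKc; set P := (coset N @*^-1 K)%G.
have nCK : K \subset 'N(C) by apply: gcore_norm.
have nNP : P \subset 'N(N) by apply: subsetIl.
have imP : P / N = K by rewrite /= cosetpreK.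
have sP : P \subset coset N @*^-1 'N(C) by apply: morphpreS.
apply: (@homomorph_factor _ hF _ _ _ _ _ P
  (comp_morphism (coset_morphism N) (coset_morphism C)) (coset_morphism _)) => //.
- exact: gcore_norm.
- rewrite ker_comp !ker_coset; apply: gcore_max.
    by rewrite (subset_trans (subsetIr _ _)) // morphpreS // gcore_sub.
  by rewrite normsI ?normG // (subset_trans _ (morphpre_norm _ _)) // morphpreS.
- rewrite (_ : (_ @* P)%G = (K / C)%G) //; apply: group_inj.
  by rewrite /= morphim_comp -[_ @* (_ @*^-1 K)]/(P / N) imP.
Qed.

Lemma vstar_homomorph : homomorph (vstar F).
Proof.
move=> gT rT G f vG y p /morphimP[x Dx Gx ->] p_pr py.
(* The preimage [x] need not be a [p]-element, but its [p]-part has the same image. *)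
have px : p.-elt x.`_p := p_elt_constt _ _.
have snx : KH_subnormal F (f @* G)%G (f @* <[x.`_p]>)%G.
  by apply: KHsn_morphim (subxx G) (vG _ p _ p_pr px); rewrite groupX.
move: snx; congr (KH_subnormal F _ _); apply: group_inj.
by rewrite /= morphim_cycle ?groupX // morph_constt // constt_p_elt.
Qed.

Lemma vstar_hereditary : hereditary (vstar F).
Proof.
move=> gT G H sHG vG x p Hx p_pr px.
have := KHsn_setI sHG (vG x p (subsetP sHG x Hx) p_pr px).
congr (KH_subnormal F _ _); apply: group_inj; apply/setIidPl.
by rewrite cycle_subG.
Qed.

Lemma vstar_mul_KHsn (gT : finGroupType) (G N : {group gT}) x (p : nat) :
  N <| G -> vstar F (G / N)%G -> x \in G -> prime p -> p.-elt x ->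
  KH_subnormal F G (N <*> <[x]>)%G.
Proof.
move=> nsNG vGN Gx p_pr px; have Nx := subsetP (normal_norm nsNG) x Gx.
have := vGN (coset N x) p (mem_quotient _ Gx) p_pr (morph_p_elt _ Nx px).
move/(KHsn_cosetpre nsNG); congr (KH_subnormal F _ _); apply: group_inj => /=.
by rewrite -quotient_cycle // quotientK ?cycle_subG // norm_joinEr ?cycle_subG.
Qed.

Lemma pgroup_KHsn (gT : finGroupType) (G H : {group gT}) (p : nat) :
  p.-group G -> H \subset G -> KH_subnormal F G H.
Proof.
by move=> pG sHG; apply: subnormal_KHsn (nilpotent_subnormal (pgroup_nil pG) sHG).
Qed.

(** The intersection of [N1 <*> <[x]>] and [N2 <*> <[x]>] is a [p]-group: its part inside [N1] meets
    [N2] trivially and embeds in a [p]-subgroup of [G / N2], and the rest embeds in a [p]-subgroup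
    of [G / N1]. In a [p]-group every subgroup is subnormal. *)
Lemma vstar_subdirect : subdirect_closed (vstar F).
Proof.
move=> gT G N1 N2 nsN1 nsN2 tiN v1 v2 x p Gx p_pr px.
have sn1 := vstar_mul_KHsn nsN1 v1 Gx p_pr px.
have sn2 := vstar_mul_KHsn nsN2 v2 Gx p_pr px.
have sBG := KHsn_sub sn2.
apply: KHsn_trans (KHsn_trans (KHsn_setI sBG sn1) sn2).
set A := (N1 <*> <[x]>)%G; set B := (N2 <*> <[x]>)%G.
have sXG : <[x]> \subset G by rewrite cycle_subG.
have nN1X := subset_trans sXG (normal_norm nsN1).
have nN2X := subset_trans sXG (normal_norm nsN2).
have pAN : p.-group (A / N1) by rewrite /= quotientYidl // morphim_pgroup.
have pBN : p.-group (B / N2) by rewrite /= quotientYidl // morphim_pgroup.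
apply: (@pgroup_KHsn _ _ _ p); last by rewrite subsetI !joing_subr.
have sABN1 : A :&: B \subset 'N(N1).
  by rewrite subIset // join_subG normG nN1X.
have sABN2 : A :&: B \subset 'N(N2).
  by rewrite subIset // orbC join_subG normG nN2X.
pose K := (N1 :&: (A :&: B))%G.
have sKN2 : K \subset 'N(N2) by apply: subset_trans (subsetIr _ _) sABN2.
have tiK : N2 :&: K = 1.
  by apply/trivgP; rewrite -tiN subsetI subsetIl (subset_trans (subsetIr _ _)) ?subsetIl.
have pK : p.-group K.
  rewrite (isog_pgroup p (quotient_isog sKN2 tiK)) (pgroupS _ pBN) //.
  by rewrite morphimS // (subset_trans (subsetIr _ _) (subsetIr _ _)).
have nKAB : A :&: B \subset 'N(K) by rewrite normsI ?normG.
rewrite -(pquotient_pgroup pK nKAB) (isog_pgroup p (second_isog sABN1)) /=.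
by rewrite (pgroupS _ pAN) //= morphimS // subsetIl.
Qed.

End KHSubnormal.

(** * Coprime action, Fitting and Frattini subgroups, soluble radical *)

Section GroupFacts.

Variable gT : finGroupType.
Implicit Types A G H M N : {group gT}.

(** [A] acts trivially on [G / H], and under coprime action fixed points of a quotient lift. *)
Lemma coprime_cent_mulR A G H :
    A \subset 'N(G) -> coprime #|G| #|A| -> solvable G ->
    H <| G -> A \subset 'N(H) -> [~: G, A] \subset H ->
  H * 'C_G(A) = G.
Proof.
move=> nGA coGA solG /andP[sHG nHG] nHA sRH.
have coHA := coprimeSg sHG coGA; have solH := solvableS sHG solG.
apply/eqP; rewrite eqEsubset mul_subG ?subsetIl //=.
rewrite -quotientSK // coprime_norm_quotient_cent // subsetI subxx /=.
by rewrite quotient_cents2r // commGC.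
Qed.

(** Write [g = r c] with [r] in [[~: G, A]] and [c] in ['C_G(A)]: then [[g, a]] is the conjugate of
    [[r, a]] by [c], and ['C_G(A)] normalises [[~: G, A, A]]. *)
Lemma coprime_commGid A G :
    A \subset 'N(G) -> coprime #|G| #|A| -> solvable G ->
  [~: G, A, A] = [~: G, A].
Proof.
move=> nGA coGA solG; apply/eqP; rewrite eqEsubset commSg ?commg_subl //=.
have nRA : A \subset 'N([~: G, A]) by rewrite commg_normr.
have nsRG : [~: G, A] <| G by rewrite /normal commg_subl nGA commg_norml.
rewrite gen_subG; apply/subsetP=> _ /imset2P[g a Gg Aa ->].
have defG := coprime_cent_mulR nGA coGA solG nsRG nRA (subxx _).
have: g \in [~: G, A] * 'C_G(A) by rewrite defG.
case/mulsgP=> r c Rr /setIP[Gc /centP cAc] ->.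
have /commgP/eqP cac := cAc a Aa.
have nCG : 'C_G(A) \subset 'N([~: G, A, A]).
  rewrite normsR // ?subIset ?(normal_norm nsRG) //.
  by rewrite (subset_trans (cent_sub A)) ?orbT.
rewrite commMgJ cac mulg1 memJ_norm ?mem_commg // (subsetP nCG) // inE Gc.
exact/centP.
Qed.

Lemma coprime_cent_Phi A G :
    A \subset 'N(G) -> coprime #|G| #|A| -> solvable G ->
  [~: G, A] \subset 'Phi(G) -> A \subset 'C(G).
Proof.
move=> nGA coGA solG sRPhi.
have nPA : A \subset 'N('Phi(G)) by apply: char_norm_trans (Phi_char G) nGA.
have := coprime_cent_mulR nGA coGA solG (Phi_normal G) nPA sRPhi.
rewrite -norm_joinEr; last by rewrite subIset // gFnorm.
move/Phi_nongen; rewrite genGid => defC.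
by rewrite centsC -defC subsetIr.
Qed.

Lemma cent_sub_Fitting G : solvable G -> 'C_G('F(G)) \subset 'F(G).
Proof.
move=> solG; set C := 'C_G('F(G)); pose Z := ('F(G) :&: C)%G.
have nsFG : 'F(G) <| G := Fitting_normal G.
have nsCG : C <| G by rewrite /C norm_normalI ?norms_cent ?normal_norm.
have nsZG : Z <| G by rewrite /Z /= normalI.
apply/idPn=> notCF.
have ntCZ : C / Z != 1.
  rewrite -subG1 quotient_sub1 ?subset_gen; last first.
    by rewrite (subset_trans (normal_sub nsCG)) ?normal_norm.
  by apply: contra notCF; rewrite subsetI => /andP[].
(* [Mb] lifts to [M] with [M / Z] elementary abelian and [Z] central in [M], so [M] is nilpotent.
   Hence [M] lies in ['F(G)] and so in [Z], a contradiction. *)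
have [Mb [sMC nsMG ntM abM]] := solvable_norm_abelem
  (quotient_sol Z (solvableS (normal_sub nsCG) solG)) (quotient_normal Z nsCG) ntCZ.
have [M defM sZM nsM] := inv_quotientN nsZG nsMG.
have sZC : Z \subset C by apply: subsetIr.
have nZG := normal_norm nsZG.
have sMC' : M \subset C.
  by rewrite -(quotientSGK _ sZC) -?defM // (subset_trans (normal_sub nsM)).
have nZM := subset_trans (normal_sub nsM) nZG.
case/negP: ntM; rewrite defM -subG1 quotient_sub1 //.
rewrite subsetI sMC' andbT; apply: Fitting_max => //.
rewrite -quotient_center_nil abelian_nil //.
apply: sub_der1_abelian; apply: subset_trans (_ : Z \subset _).
  rewrite der1_min //.
  by rewrite -defM; case/is_abelemP: abM => p _ /abelem_abelian.
rewrite subsetI sZM centsC (subset_trans sMC') // (subset_trans (subsetIr _ _)) //.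
by rewrite centS // subsetIl.
Qed.

(** If a maximal subgroup [M] did not contain ['Phi(N)], then [G] would be the product of ['Phi(N)]
    and [M]; by Dedekind's law ['Phi(N)] and [N :&: M] would generate [N], forcing [N] into [M]. *)
Lemma PhiS_normal N G : N <| G -> 'Phi(N) \subset 'Phi(G).
Proof.
move=> nsNG; have [sNG nNG] := andP nsNG.
have nsPG : 'Phi(N) <| G := char_normal_trans (Phi_char N) nsNG.
apply/bigcapsP=> M; rewrite /maximal_eq => /predU1P[->|maxM].
  exact: normal_sub nsPG.
have [/andP[sMG neMG] maxGM] := maxgroupP maxM.
have nPM : M \subset 'N('Phi(N)) := subset_trans sMG (normal_norm nsPG).
apply/idPn=> notPM.
have defG : 'Phi(N) * M = G.
  rewrite -norm_joinEr //; apply/eqP/idPn=> neqG; case/negP: notPM.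
  rewrite -(maxGM ('Phi(N) <*> M)%G) ?joing_subl ?joing_subr //.
  by rewrite properEneq neqG join_subG sMG normal_sub.
have defN : 'Phi(N) <*> (N :&: M) = N.
  rewrite norm_joinEr; last by rewrite subIset // nPM orbT.
  by rewrite /= setIC group_modl ?Phi_sub // defG; apply/setIidPr.
move/Phi_nongen: defN; rewrite genGid => defN; case/negP: notPM.
by rewrite (subset_trans (Phi_sub N)) // -defN subsetIr.
Qed.

(** The Frattini argument, together with the non-generator property, makes every Sylow subgroup of
    ['Phi(G)] normal in [G]. *)
Lemma Phi_nilpotent G : nilpotent 'Phi(G).
Proof.
suff -> : 'Phi(G) = 'F('Phi(G)) by apply: Fitting_nil.
apply/eqP; rewrite eqEsubset Fitting_sub andbT -{1}(Sylow_gen 'Phi(G)).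
rewrite gen_subG; apply/bigcupsP=> P /SylowP[p p_pr sylP].
have sPG := pHall_sub sylP.
have defG : 'Phi(G) * 'N_G(P) = G := Frattini_arg (Phi_normal G) sylP.
apply: Fitting_max (pgroup_nil (pHall_pgroup sylP)).
rewrite /normal sPG (subset_trans (Phi_sub G)) //.
move: defG; rewrite -norm_joinEr; last by rewrite subIset // gFnorm.
by move/Phi_nongen; rewrite genGid => <-; apply: subsetIr.
Qed.

Lemma solvable_Phi_quotient G : solvable (G / 'Phi(G)) -> solvable G.
Proof.
move=> solGq; rewrite (series_sol (Phi_normal G)) solGq andbT.
exact: nilpotent_sol (Phi_nilpotent G).
Qed.

Lemma sol_radical_normal G : sol_radical G <| G.
Proof.
rewrite /normal gen_subG norms_gen ?andbT /=.
  by apply/bigcupsP=> H /andP[/normal_sub].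
by apply: norms_bigcup; apply/bigcapsP=> H /andP[/normal_norm].
Qed.

(** A soluble normal subgroup of largest order absorbs every other one, since the product of two is
    again soluble and normal. *)
Lemma sol_radical_solvable G : solvable (sol_radical G).
Proof.
pose P (H : {group gT}) := (H <| G) && solvable H.
have P1 : P 1%G by rewrite /P normal1 solvable1.
case: (@arg_maxnP _ 1%G P (fun H => #|H|) P1) => M /andP[nsMG solM] maxM.
apply: (solvableS _ solM); rewrite gen_subG; apply/bigcupsP=> H /andP[nsHG solH].
have nMH : H \subset 'N(M) := subset_trans (normal_sub nsHG) (normal_norm nsMG).
have nsMMH : M <| M <*> H by rewrite /normal joing_subl join_subG normG.
have PMH : P (M <*> H)%G.
  rewrite /P normalY //= (series_sol nsMMH) solM /=.
  by rewrite quotientYidl // quotient_sol.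
have /= := maxM _ PMH => leMH.
have /eqP eqM : M :==: M <*> H by rewrite eqEcard joing_subl.
by rewrite eqM joing_subr.
Qed.

End GroupFacts.

(** * Roots of unity and eigenmaps of a cyclic p-group acting on a q-group *)

Lemma field_prim_root (q m : nat) : prime q -> 0 < m -> coprime q m ->
  exists K : fieldType, q \in [pchar K]%R /\ exists w : K, m.-primitive_root%R w.
Proof.
move=> q_pr m_gt0 coqm; have k_gt0 : 0 < totient m by rewrite totient_gt0.
(* By Euler's theorem [m] divides [q ^ totient m - 1], the order of the cyclic multiplicative group
   of this field. *)
have [K charK cardK] := pPrimePowerField q_pr k_gt0.
exists K; split=> //; pose n := (#|K|).-1.
have cardK1 : 1 < #|K| by rewrite cardK -(exp1n (totient m)) ltn_exp2r ?prime_gt1.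
have n_gt0 : 0 < n by rewrite /n -subn1 subn_gt0.
have dvd_m_n : m %| n.
  by rewrite /n -subn1 -eqn_mod_dvd 1?ltnW // cardK Euler_exp_totient.
pose rs := [seq x <- enum K | x != 0%R].
have: has n.-primitive_root%R rs.
  apply: has_prim_root => //.
  - apply/allP=> x; rewrite mem_filter unity_rootE => /andP[nz_x _].
    apply/eqP/(mulfI nz_x); rewrite mulr1 -exprS prednK ?expf_card //.
    exact: ltnW.
  - by rewrite filter_uniq ?enum_uniq.
  by rewrite /n -(cardC1 (0%R : K)) cardE /rs {1}/enum_mem size_filter -enumT size_filter.
by case/hasP=> w _ prim_w; exists (w ^+ (n %/ m))%R; apply: dvdn_prim_root.
Qed.

Section AdditiveMaps.

Variables (K : fieldType) (gT : finGroupType) (Q : {group gT}) (psi : gT -> K).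
Hypothesis psiM : {in Q &, {morph psi : u v / u * v >-> (u + v)%R}}.

Lemma addmap1 : psi 1 = 0%R.
Proof. by apply: (addrI (psi 1)); rewrite -psiM // mulg1 addr0. Qed.

Lemma addmapV : {in Q, forall u, psi u^-1 = - psi u}%R.
Proof.
by move=> u Qu; apply: (addrI (psi u)); rewrite -psiM ?groupV // mulgV subrr addmap1.
Qed.

(** Since [K] is only a field type, [psi] is a plain function and not a [morphism]; its kernel is
    therefore set up by hand. *)
Definition addmap_ker := [set u in Q | psi u == 0%R].

Lemma addmap_ker_group_set : group_set addmap_ker.
Proof.
apply/group_setP; split=> [|u v]; first by rewrite inE group1 addmap1 /=.
rewrite !inE => /andP[Qu /eqP u0] /andP[Qv /eqP v0].
by rewrite groupM // psiM // u0 v0 addr0 /=.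
Qed.
Canonical addmap_ker_group := Group addmap_ker_group_set.

Lemma addmap_inj : addmap_ker = 1 -> {in Q &, injective psi}.
Proof.
move=> ker1 u v Qu Qv eq_uv; apply/eqP; rewrite eq_mulgV1 -in_set1 -[[set 1]]ker1.
by rewrite inE groupM ?groupV //= psiM ?groupV // addmapV // eq_uv subrr.
Qed.

Variables (x : gT) (a : K).
Hypotheses (nQx : x \in 'N(Q)) (psiJ : {in Q, forall u, psi (u ^ x) = (a * psi u)%R}).

Lemma addmapJX k : {in Q, forall u, psi (u ^ (x ^+ k)) = (a ^+ k * psi u)%R}.
Proof.
move=> u Qu; elim: k => [|k IH]; first by rewrite conjg1 mul1r.
by rewrite expgSr conjgM psiJ ?memJ_norm ?groupX // IH mulrA -exprS.
Qed.

Lemma addmap_kerJ : <[x]> \subset 'N(addmap_ker).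
Proof.
rewrite cycle_subG inE; apply/subsetP=> _ /imsetP[u + ->].
rewrite !inE memJ_norm // => /andP[Qu /eqP u0].
by rewrite Qu psiJ // u0 mulr0 /=.
Qed.

(** [psi] is invariant under [x ^+ k]. This later rules out eigenvalues of too small an order. *)
Lemma addmap_commg k : (a ^+ k = 1)%R -> [~: Q, <[x ^+ k]>] \subset addmap_ker.
Proof.
move=> ak1; rewrite gen_subG; apply/subsetP=> _ /imset2P[u _ Qu /cycleP[i ->] ->].
have Qui : u ^ (x ^+ k ^+ i) \in Q by rewrite memJ_norm ?groupX.
rewrite !inE commgEl groupM ?groupV //= psiM ?groupV // addmapV //.
by rewrite -expgM addmapJX // exprM ak1 expr1n mul1r addNr.
Qed.

End AdditiveMaps.

Lemma maximal_addmap (K : fieldType) (q : nat) (gT : finGroupType)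
    (Q M : {group gT}) :
    q \in [pchar K]%R -> q.-group Q -> maximal M Q ->
  exists2 psi : gT -> K, {in Q &, {morph psi : u v / u * v >-> (u + v)%R}}
    & addmap_ker Q psi = M.
Proof.
move=> charK qQ maxM; have q_pr := pcharf_prime charK.
have [sMQ nMQ] := andP (p_maximal_normal qQ maxM).
have oQM : #|Q / M| = q by rewrite card_quotient // (p_maximal_index qQ maxM).
have /cyclicP[a defQM] : cyclic (Q / M) by rewrite prime_cyclic ?oQM.
have oa : #[a] = q by rewrite orderE -defQM.
(* The exponent [f v] matters only modulo [q], so any choice becomes additive once read in [K], of
   characteristic [q]. *)
have [f fP] : exists f : gT -> nat, forall v, v \in Q -> coset M v = a ^+ f v.
  apply: (@fin_all_exists gT (fun=> nat) (fun v i => v \in Q -> coset M v = a ^+ i)).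
  move=> v; have [Qv|] := boolP (v \in Q); last by exists 0.
  have: coset M v \in <[a]> by rewrite -defQM mem_quotient.
  by case/cycleP=> i; exists i.
exists (fun v => (f v)%:R)%R => [u v Qu Qv|].
  have: a ^+ f (u * v) == a ^+ (f u + f v).
    by rewrite expgD -!fP ?groupM // morphM // (subsetP nMQ).
  rewrite eq_expg_mod_order oa => /eqP eq_f.
  by rewrite /= -natrD -(GRing.natr_mod_pchar charK) eq_f GRing.natr_mod_pchar.
apply/setP=> v; rewrite inE -(dvdn_pcharf charK) -oa order_dvdn.
have [Qv | notQv] := boolP (v \in Q); last first.
  by apply/esym/negP=> /(subsetP sMQ); apply/negP.
by rewrite -fP //=; apply/eqP/idP => [/coset_idr->|/coset_id//]; rewrite ?(subsetP nMQ).
Qed.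

(* A component of Q -> Z/q -> K under averaging against the powers of w; the map
   Q -> Z/q is chosen not to kill [Q, x ^ (p ^ n)], which forces the eigenvalue
   to be primitive. *)
Lemma eigen_addmap (K : fieldType) (q p n : nat) (gT : finGroupType)
    (Q : {group gT}) (x : gT) (w : K) :
    q \in [pchar K]%R -> q.-group Q -> prime p -> p != q -> p.-elt x -> x \in 'N(Q) ->
    (p ^ n.+1).-primitive_root%R w ->
    x ^+ (p ^ n.+1) \in 'C(Q) -> x ^+ (p ^ n) \notin 'C(Q) ->
  exists (a : K) (psi : gT -> K),
    [/\ (p ^ n.+1).-primitive_root%R a,
        {in Q &, {morph psi : u v / u * v >-> (u + v)%R}},
        {in Q, forall u, psi (u ^ x) = (a * psi u)%R}
      & exists2 v, v \in Q & psi v != 0%R].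
Proof.
move=> charK qQ p_pr neqpq px nQx prim_w cQxm not_cQz.
set m := (p ^ n.+1)%N in prim_w cQxm *; set z := x ^+ (p ^ n) in not_cQz *.
have m_gt0 : 0 < m by rewrite expn_gt0 prime_gt0.
(* Otherwise [[~: Q, <[z]>]] lies in ['Phi(Q)], and coprimality makes [z] centralise [Q]. *)
have [M maxM notRM] : exists2 M : {group gT}, maximal M Q & ~~ ([~: Q, <[z]>] \subset M).
  apply/exists_inP; apply: contraR not_cQz => noM; rewrite -cycle_subG.
  apply: (coprime_cent_Phi _ _ (pgroup_sol qQ)).
  - by rewrite cycle_subG groupX.
  - have pz : p.-elt z by apply: mem_p_elt px (mem_cycle x _).
    by apply: (@pnat_coprime q) => //; apply: (pi_pnat pz); rewrite !inE.
  apply/bigcapsP=> M; rewrite /maximal_eq => /predU1P[->|maxM].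
    by rewrite commg_subl cycle_subG groupX.
  by apply: contraR noM => notRM; apply/exists_inP; exists M.
have [chi chiM kerchi] := maximal_addmap charK qQ maxM.
have [v Rv nz_v] : exists2 v, v \in [~: Q, <[z]>] & chi v != 0%R.
  case/subsetPn: notRM => v Rv; rewrite -kerchi inE negb_and => nz_v.
  exists v => //; case/orP: nz_v => // /negP[]; apply: subsetP Rv.
  by rewrite commg_subl cycle_subG groupX.
have Qv : v \in Q by apply: subsetP Rv; rewrite commg_subl cycle_subG groupX.
(* Up to the factor [m], this projects [chi] onto the [w ^+ i]-eigenspace of the action of [x]. *)
pose psi i u := (\sum_(j < m) (w ^+ i) ^- j * chi (u ^ (x ^+ j))%g)%R.
have nz_w : w != 0%R.
  apply/eqP=> w0; have /eqP := prim_expr_order prim_w.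
  by rewrite w0 expr0n gtn_eqF // eq_sym oner_eq0.
have psiM i : {in Q &, {morph psi i : u1 u2 / u1 * u2 >-> (u1 + u2)%R}}.
  move=> u1 u2 Qu1 Qu2; rewrite /psi -big_split /=; apply: eq_bigr => j _.
  by rewrite conjMg chiM ?memJ_norm ?groupX // mulrDr.
have psiJ i : {in Q, forall u, psi i (u ^ x) = (w ^+ i * psi i u)%R}.
  (* Shift the index by one; the term that wraps around fits because [x ^+ m] centralises [Q] and
     [w ^+ m = 1]. *)
  move=> u Qu; rewrite /psi; case: {+}m m_gt0 cQxm prim_w => // m' _ cQxm prim_w.
  rewrite big_ord_recr big_ord_recl /= addrC mulrDr; congr (_ + _)%R.
    rewrite expr0 invr1 mul1r conjg1 -conjgM -expgS /conjg.
    rewrite -(centP cQxm u Qu) mulKg; congr (_ * _)%R.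
    apply: (mulIf (expf_neq0 m' (expf_neq0 i nz_w))).
    by rewrite mulVf ?expf_neq0 // -exprS exprAC (prim_expr_order prim_w) expr1n.
  rewrite big_distrr /=; apply: eq_bigr => j _.
  rewrite -conjgM -expgS /bump /= add1n exprS mulrA invfM mulrA mulfV ?mul1r //.
  by rewrite expf_neq0.
(* Orthogonality: for [j] nonzero, the sum over [i] of the powers of [w ^- j] vanishes. *)
have sum_psi : (\sum_(i < m) psi i v = m%:R * chi v)%R.
  rewrite exchange_big (bigD1 (Ordinal m_gt0)) //= [X in (_ + X)%R]big1 => [|j nz_j].
    rewrite addr0 conjg1 -big_distrl /= (eq_bigr (fun=> 1%R)) => [|i _].
      by rewrite big_const_ord iter_addr_0.
    by rewrite invr1.
  rewrite -big_distrl /=; set s := (X in (X * _)%R).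
  suff -> : s = 0%R by rewrite mul0r.
  have neq_j1 : ((w ^- j) - 1 != 0)%R.
    rewrite subr_eq0 -[1%R]invr1 (inj_eq invr_inj).
    rewrite -(prim_order_dvd prim_w) gtnNdvd // lt0n.
    by apply: contra nz_j => /eqP j0; apply/eqP/val_inj.
  apply/eqP; rewrite -(inj_eq (mulfI neq_j1)) mulr0.
  rewrite /s (eq_bigr (fun i : 'I_m => (w ^- j) ^+ i)%R) => [|i _]; last first.
    by rewrite -exprM mulnC exprM exprVn.
  by rewrite -subrX1 exprVn exprAC (prim_expr_order prim_w) expr1n invr1 subrr.
have [i nz_i] : exists i : 'I_m, psi i v != 0%R.
  apply/existsP; apply: contraR nz_v => /existsPn nz.
  rewrite -(inj_eq (mulfI (prim_root_natf_neq0 prim_w))) mulr0 -sum_psi.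
  by rewrite big1 // => i _; apply/eqP; rewrite -[_ == _]negbK nz.
exists (w ^+ i)%R, (psi i); split=> //; last by exists v.
(* The order of [w ^+ i] is a power of [p] dividing [m]. If smaller than [m], it divides [p ^ n],
   and then [psi i] kills [[~: Q, <[z]>]], which contains [v]. *)
have wim1 : ((w ^+ i) ^+ m = 1)%R by rewrite exprAC (prim_expr_order prim_w) expr1n.
have [d prim_d dvd_d] := prim_order_exists m_gt0 wim1.
have /(dvdn_pfactor _ _ p_pr)[e le_e def_d] := dvd_d.
move: prim_d; rewrite def_d.
move: le_e; rewrite leq_eqVlt => /predU1P[-> //| lt_e] prim_e.
have : ((w ^+ i) ^+ (p ^ n) = 1)%R.
  by apply/eqP; rewrite -(prim_order_dvd prim_e) dvdn_exp2l.
move/(addmap_commg (psiM i) nQx (psiJ i))=> sRker.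
by have := subsetP sRker v Rv; rewrite inE Qv (negPf nz_i).
Qed.

(* An isomorphism between an eigen-section of Q and the minimal module N is
   obtained by matching elements with equal values under the additive maps h and
   phi, on which u and y act as multiplication by the same scalar b. *)
Section FibreMap.

Variables (K : fieldType) (gT1 gT2 : finGroupType).
Variables (Q : {group gT1}) (u : gT1) (N : {group gT2}) (y : gT2) (b : K).
Variables (h : gT1 -> K) (phi : gT2 -> K) (D : {group gT2}).
Hypotheses (nQu : u \in 'N(Q)) (nNy : y \in 'N(N)).
Hypotheses (hM : {in Q &, {morph h : s t / s * t >-> (s + t)%R}})
           (phiM : {in N &, {morph phi : s t / s * t >-> (s + t)%R}}).
Hypotheses (hJ : {in Q, forall s, h (s ^ u) = (b * h s)%R})
           (phiJ : {in N, forall s, phi (s ^ y) = (b * phi s)%R}).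
Hypothesis ker_phi : addmap_ker N phi = 1.

Let phi_inj : {in N &, injective phi} := addmap_inj phiM ker_phi.

(** The values of [h] need not lie in [phi @: N]; this is the part of [Q] where the inverse of [phi]
    can be applied after [h]. *)
Definition fibre_map_dom := [set v in Q | [exists s in N, h v == phi s]].
(* Junk value 1 outside fibre_map_dom. *)
Definition fibre_map v := odflt 1 [pick s in N | h v == phi s].

Lemma fibre_mapP v : v \in fibre_map_dom -> fibre_map v \in N /\ phi (fibre_map v) = h v.
Proof.
rewrite inE => /andP[_ /exists_inP[s Ns hs]]; rewrite /fibre_map.
by case: pickP => [t /andP[Nt /eqP] | /(_ s)]; rewrite ?Ns ?hs.
Qed.

Lemma fibre_map_uniq v s : v \in fibre_map_dom -> s \in N -> phi s = h v -> fibre_map v = s.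
Proof. by case/fibre_mapP=> [Nt phi_t] Ns phi_s; apply: phi_inj; rewrite ?phi_t. Qed.

Lemma fibre_map_dom_mem v s : v \in Q -> s \in N -> phi s = h v -> v \in fibre_map_dom.
Proof. by move=> Qv Ns phis; rewrite inE Qv; apply/exists_inP; exists s; rewrite ?phis. Qed.

Lemma fibre_map_dom_sub : fibre_map_dom \subset Q.
Proof. by apply/subsetP=> v; rewrite inE => /andP[]. Qed.

Lemma fibre_map_dom_group_set : group_set fibre_map_dom.
Proof.
apply/group_setP; split=> [|v w Wv Ww].
  by apply: (@fibre_map_dom_mem _ 1); rewrite // (addmap1 phiM) (addmap1 hM).
have [[Nv pv] [Nw pw]] := (fibre_mapP Wv, fibre_mapP Ww).
have [Qv Qw] := (subsetP fibre_map_dom_sub v Wv, subsetP fibre_map_dom_sub w Ww).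
apply: (@fibre_map_dom_mem _ (fibre_map v * fibre_map w)); rewrite ?groupM //.
by rewrite phiM // hM // pv pw.
Qed.
Canonical fibre_map_dom_group := Group fibre_map_dom_group_set.

Lemma fibre_mapM : {in fibre_map_dom &, {morph fibre_map : v w / v * w}}.
Proof.
move=> v w Wv Ww; have [[Nv pv] [Nw pw]] := (fibre_mapP Wv, fibre_mapP Ww).
apply: fibre_map_uniq; rewrite ?groupM // phiM // pv pw hM //.
  exact: subsetP fibre_map_dom_sub v Wv.
exact: subsetP fibre_map_dom_sub w Ww.
Qed.
Canonical fibre_map_morphism := Morphism fibre_mapM.

Lemma fibre_mapJ k v : v \in fibre_map_dom ->
  v ^ (u ^+ k) \in fibre_map_dom /\ fibre_map (v ^ (u ^+ k)) = fibre_map v ^ (y ^+ k).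
Proof.
move=> Wv; have [Nv pv] := fibre_mapP Wv.
have Qv := subsetP fibre_map_dom_sub v Wv.
have Nvy : fibre_map v ^ (y ^+ k) \in N by rewrite memJ_norm ?groupX.
have eqh : phi (fibre_map v ^ (y ^+ k)) = h (v ^ (u ^+ k)).
  by rewrite (addmapJX nNy phiJ) // (addmapJX nQu hJ) // pv.
have Wvu : v ^ (u ^+ k) \in fibre_map_dom.
  by apply: fibre_map_dom_mem Nvy eqh; rewrite memJ_norm ?groupX.
by split=> //; apply: fibre_map_uniq.
Qed.

(** The image is nontrivial because [h v] is nonzero, stable under [y] by equivariance, and stable
    under [N], which is abelian because it embeds in the additive group of [K]. *)
Lemma fibre_map_im v :
    v \in fibre_map_dom -> h v != 0%R -> minnormal N (N <*> <[y]>) ->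
  fibre_map @* fibre_map_dom = N.
Proof.
move=> Wv nz_hv /mingroupP[_ minN].
apply: minN; last by apply/subsetP=> _ /morphimP[w _ Ww ->]; have [] := fibre_mapP Ww.
have cNN : abelian N.
  by apply/centsP=> s Ns t Nt; apply: phi_inj; rewrite ?groupM // !phiM // addrC.
have sWN : fibre_map @* fibre_map_dom \subset N.
  by apply/subsetP=> _ /morphimP[w _ Ww ->]; have [] := fibre_mapP Ww.
apply/andP; split.
  apply: contraNneq nz_hv => im1; have [_ <-] := fibre_mapP Wv.
  have: fibre_map v \in fibre_map @* fibre_map_dom by apply: mem_morphim.
  by rewrite im1 => /set1P->; rewrite (addmap1 phiM).
rewrite join_subG cents_norm; last by rewrite centsC (subset_trans sWN) // -abelianE.
rewrite cycle_subG inE; apply/subsetP=> _ /imsetP[_ /morphimP[w _ Ww ->] ->].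
by have [Wwu <-] := fibre_mapJ 1 Ww; apply: mem_morphim.
Qed.

Hypotheses (tiQu : coprime #|Q| #[u]) (nsDY : D <| N <*> <[y]>).
Hypothesis Dyu : y ^+ #[u] \in D.

(** The fibre map on its domain [W] and the map from [u] to [coset D y] glue to a morphism from the
    semidirect product of [W] by [<[u]>] onto the target; [Dyu] makes the second map well
    defined. *)
Lemma fibre_map_homomorph (F : gclass) v :
    homomorph F -> hereditary F -> F _ (Q <*> <[u]>)%G ->
    v \in fibre_map_dom -> h v != 0%R -> minnormal N (N <*> <[y]>) ->
  F _ ((N <*> <[y]>) / D)%G.
Proof.
move=> hF sF FQu Wv nz_hv minN.
have nDY := normal_norm nsDY.
have [nDN nDy] : N \subset 'N(D) /\ y \in 'N(D).
  by apply/andP; rewrite -cycle_subG -join_subG.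
pose W := fibre_map_dom_group.
have nWu : <[u]> \subset 'N(W).
  rewrite cycle_subG inE; apply/subsetP=> _ /imsetP[w Ww ->].
  by have [] := fibre_mapJ 1 Ww.
have tiWu : W :&: <[u]> = 1.
  by apply: coprime_TIg; apply: coprimeSg tiQu; apply: fibre_map_dom_sub.
have defWu := sdprodEY nWu tiWu.
have fDM : {in W &, {morph (fun v => coset D (fibre_map v)) : s t / s * t}}.
  move=> s t Ws Wt; rewrite /= fibre_mapM // morphM // (subsetP nDN) //.
    by have [] := fibre_mapP Ws.
  by have [] := fibre_mapP Wt.
have dvd_yu : #[coset D y] %| #[u].
  by rewrite order_dvdn -morphX //= coset_id.
have actf : {in W & <[u]>, morph_act 'J 'J (Morphism fDM) (eltm dvd_yu)}.
  move=> w _ Ww /cycleP[i ->] /=; rewrite /= eltmE.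
  have [_ ->] := fibre_mapJ i Ww; have [Nw _] := fibre_mapP Ww.
  by rewrite morphJ ?morphX ?groupX // (subsetP nDN).
have FWu : F _ (W <*> <[u]>)%G.
  by apply: sF FQu; rewrite genS // setSU // fibre_map_dom_sub.
have := hF _ _ _ (sdprodm_morphism defWu actf) FWu.
congr (F _ _); apply: group_inj; rewrite /= im_sdprodm im_eltm.
rewrite norm_joinEr ?cycle_subG // quotientMl // quotient_cycle //.
congr (_ * _); rewrite -[RHS]/(N / D) -(fibre_map_im Wv nz_hv minN).
rewrite /quotient !morphimEsub //=; first by rewrite -imset_comp.
by apply/subsetP=> _ /imsetP[w Ww ->]; have [Nw _] := fibre_mapP Ww; apply: subsetP Nw.
Qed.

End FibreMap.

(** * Actions of p-elements on q-groups *)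

Section ActionOnQGroups.

Variables (F : gclass) (hF : homomorph F) (sF : hereditary F).
Variables (p q : nat) (p_pr : prime p) (q_pr : prime q) (neq_pq : p != q).

(** An eigenvalue [b] of [y] is a power [a ^+ k] of a primitive eigenvalue [a] of [x]. Hence
    [x ^+ k] and [y] scale their eigenmaps alike, and the fibre map applies. *)
Lemma homomorph_minnormal_action (n : nat) (gT1 gT2 : finGroupType)
    (Q X : {group gT1}) (x : gT1) (N : {group gT2}) (y : gT2) :
    F X -> Q \subset X -> x \in X ->
    q.-group Q -> p.-elt x -> x \in 'N(Q) ->
    x ^+ (p ^ n.+1) \in 'C(Q) -> x ^+ (p ^ n) \notin 'C(Q) ->
    q.-group N -> p.-elt y -> minnormal N (N <*> <[y]>) ->
    y ^+ (p ^ n.+1) \in 'C(N) -> y \notin 'C(N) ->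
  F ((N <*> <[y]>) / gcore <[y]> (N <*> <[y]>))%G.
Proof.
move=> FX sQX Xx qQ px nQx cQx ncQx qN py minN cNy ncNy.
have nNy : y \in 'N(N).
  have /mingroupP[/andP[_ nNY] _] := minN.
  by rewrite (subsetP nNY) // mem_gen // inE cycle_id orbT.
have co_qm : coprime q (p ^ n.+1).
  by rewrite coprimeXr // prime_coprime // dvdn_prime2 // eq_sym.
have m_gt0 e : 0 < p ^ e by rewrite expn_gt0 prime_gt0.
have [K [charK [w prim_w]]] := field_prim_root q_pr (m_gt0 n.+1) co_qm.
have exl : exists e, y ^+ (p ^ e) \in 'C(N) by exists n.+1.
(* [p ^ l.+1] is the order of the automorphism of [N] induced by [y]. *)
have [[|l] cNyl min_l] := ex_minnP exl; first by rewrite cNyl in ncNy.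
have le_ln : l <= n by rewrite -ltnS min_l.
have ncNyl : y ^+ (p ^ l) \notin 'C(N).
  by apply/negP=> /min_l; rewrite ltnn.
have dvd_ln : p ^ l.+1 %| p ^ n.+1 by rewrite dvdn_exp2l.
have [a [psi [prim_a psiM psiJ [v0 Qv0 nz_v0]]]] :=
  eigen_addmap charK qQ p_pr neq_pq px nQx prim_w cQx ncQx.
have [b [phi [prim_b phiM phiJ [s0 Ns0 nz_s0]]]] :=
  eigen_addmap charK qN p_pr neq_pq py nNy (dvdn_prim_root prim_w dvd_ln) cNyl ncNyl.
have [k def_b] : {k : 'I_(p ^ n.+1) | b = (a ^+ k)%R}.
  by apply: (prim_rootP prim_a); rewrite -(divnK dvd_ln) mulnC exprM (prim_expr_order prim_b) expr1n.
(* The scaling gives [h v0 = phi s0], which puts [v0] in the domain of the fibre map. *)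
pose u := x ^+ k; pose h v := (phi s0 / psi v0 * psi v)%R.
have nQu : u \in 'N(Q) by rewrite groupX.
have hM : {in Q &, {morph h : s t / s * t >-> (s + t)%R}}.
  by move=> s t Qs Qt; rewrite /h psiM // mulrDr.
have hJ : {in Q, forall s, h (s ^ u) = (b * h s)%R}.
  by move=> s Qs; rewrite /h (addmapJX nQx psiJ) // def_b mulrCA.
have hv0 : h v0 = phi s0 by rewrite /h mulfVK.
(* The kernel is normalised by [N] and [y] and omits [s0], so minimality of [N] makes it trivial. *)
have ker_phi : addmap_ker N phi = 1.
  have [_ minN1] := mingroupP minN.
  apply/eqP/idPn=> ntL; pose L := addmap_ker_group phiM.
  case/negP: nz_s0; suff: s0 \in L by rewrite inE => /andP[].
  rewrite (minN1 L) //; last by apply/subsetP=> s; rewrite inE => /andP[].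
  rewrite ntL join_subG (addmap_kerJ nNy phiJ) andbT.
  apply/subsetP=> t Nt; rewrite inE; apply/subsetP=> _ /imsetP[s + ->].
  rewrite !inE => /andP[Ns /eqP s0_0]; rewrite groupJ //= conjgE.
  rewrite !phiM ?groupM ?groupV // s0_0 add0r -phiM ?groupV //.
  by rewrite mulVg (addmap1 phiM).
have coQu : coprime #|Q| #[u].
  have pu : p.-elt u by apply: mem_p_elt px (mem_cycle x _).
  by apply: (@pnat_coprime q) => //; apply: (pi_pnat pu); rewrite !inE.
have Wv0 : v0 \in fibre_map_dom Q N h phi by apply: fibre_map_dom_mem Ns0 _.
have nz_hv0 : h v0 != 0%R by rewrite hv0.
have sDY : <[y]> \subset N <*> <[y]> by apply: joing_subr.
(* As [b] has order [p ^ l.+1] and [b ^+ #[u] = 1], the element [y ^+ #[u]] centralises [N]. *)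
have Dyu : y ^+ #[u] \in gcore <[y]> (N <*> <[y]>).
  have bu1 : (b ^+ #[u] = 1)%R.
    apply: (mulIf nz_hv0); rewrite mul1r -(addmapJX nQu hJ) //.
    by rewrite expg_order conjg1.
  have /dvdnP[e ->] : p ^ l.+1 %| #[u] by rewrite (prim_order_dvd prim_b) bu1.
  rewrite -cycle_subG; apply: gcore_max; first by rewrite cycle_subG mem_cycle.
  rewrite join_subG cents_norm; last first.
    by rewrite centsC cycle_subG mulnC expgM groupX.
  rewrite cents_norm // (sub_abelian_cent2 (cycle_abelian y)) // cycle_subG.
  exact: mem_cycle.
have FQu : F (Q <*> <[u]>)%G.
  by apply: sF FX; rewrite join_subG sQX cycle_subG groupX.
exact: (fibre_map_homomorph nQu nNy hM phiM hJ phiJ ker_phi coQu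
  (gcore_normal (H := <[y]>) (K := N <*> <[y]>) sDY) Dyu hF sF FQu Wv0 nz_hv0 minN).
Qed.

(** Induction on the order of [N], through a minimal normal subgroup [M] of [N <*> <[y]>] inside
    [N]: the chain runs through [M <*> <[y]>]. If [M = N], either [y] centralises [N] or a single
    core-quotient step suffices. *)
Lemma coprime_action_KHsn (n : nat) (gT1 : finGroupType)
    (Q X : {group gT1}) (x : gT1) :
    F X -> Q \subset X -> x \in X ->
    q.-group Q -> p.-elt x -> x \in 'N(Q) ->
    x ^+ (p ^ n.+1) \in 'C(Q) -> x ^+ (p ^ n) \notin 'C(Q) ->
  forall (gT2 : finGroupType) (N : {group gT2}) (y : gT2),
    q.-group N -> p.-elt y -> y \in 'N(N) -> y ^+ (p ^ n.+1) \in 'C(N) ->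
  KH_subnormal F (N <*> <[y]>)%G <[y]>%G.
Proof.
move=> FX sQX Xx qQ px nQx cQx ncQx gT2 N.
have [r] := ubnP #|N|; elim: r gT2 N => // r IH gT2 N leNr y qN py nNy cNy.
set Y := (N <*> <[y]>)%G; have sNY : N \subset Y := joing_subl _ _.
have sYY : <[y]> \subset Y := joing_subr _ _.
have [N1 | ntN] := eqVneq (N : {set gT2}) 1.
  rewrite (_ : Y = <[y]>%G); first exact: KHsn_top.
  by apply: group_inj; rewrite /= N1 joing1G.
have nNY : Y \subset 'N(N) by rewrite join_subG normG cycle_subG.
have [M minM sMN] := minnormal_exists ntN nNY.
have [/andP[ntM nMY] _] := mingroupP minM.
have nsMY : M <| Y by rewrite /normal (subset_trans sMN).
have nMy : y \in 'N(M) by rewrite (subsetP nMY) // -cycle_subG.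
have [/group_inj eqMN | neqMN] := eqVneq (M : {set gT2}) N.
  rewrite eqMN in minM.
  have [cy | ncy] := boolP (y \in 'C(N)).
    apply: normal_KHsn; rewrite /normal sYY join_subG normG andbT.
    by rewrite cents_norm // centsC cycle_subG.
  apply: KHsn_step (KHsn_top F Y) sYY _; right.
  exact: (@homomorph_minnormal_action n _ _ Q X x N y).
have prMN : M \proper N by rewrite properEneq neqMN.
have ltMN := proper_card prMN.
have nMN : N \subset 'N(M) := subset_trans sNY nMY.
have snM : KH_subnormal F (M <*> <[y]>)%G <[y]>%G.
  apply: IH => //; first exact: leq_trans ltMN _.
    exact: pgroupS sMN qN.
  by apply: subsetP cNy; apply: centS.
apply: KHsn_trans snM _.
have snNM : KH_subnormal F (N / M <*> <[coset M y]>)%G <[coset M y]>%G.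
  apply: IH.
  - by rewrite (leq_trans _ (leNr : #|N| <= r)) // ltn_quotient.
  - exact: quotient_pgroup.
  - exact: morph_p_elt.
  - by rewrite -cycle_subG -quotient_cycle // quotient_norms // cycle_subG.
  - by rewrite -morphX // -cycle_subG -quotient_cycle ?groupX // quotient_cents // cycle_subG.
have eqYM : (N / M <*> <[coset M y]>)%G = (Y / M)%G.
  by apply: group_inj; rewrite /= quotientY ?cycle_subG // quotient_cycle.
rewrite eqYM in snNM.
have := KHsn_cosetpre hF nsMY snNM; congr (KH_subnormal F _ _); apply: group_inj => /=.
by rewrite -quotient_cycle // quotientK ?cycle_subG // norm_joinEr ?cycle_subG.
Qed.

(** Going down the chain, some step first loses [[~: Q, <[z]>]]. It cannot be a normal step, because
    [[~: Q, <[z]>]] equals its own commutator with [z]; so its core quotient lies in [F]. *)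
Lemma KHsn_nontrivial_section (gT : finGroupType) (G H Q : {group gT}) (x z : gT) :
    KH_subnormal F G H -> x \in H -> Q <| G -> q.-group Q -> p.-elt x -> z \in <[x]> ->
    ~~ ([~: Q, <[z]>] \subset H) ->
  exists K C : {group gT}, [/\ C <| K, K \subset G, x \in K, F (K / C)%G
    & ~~ ([~: Q :&: K, <[z]>] \subset C)].
Proof.
move=> snH + nsQG qQ px xz; have nQG := normal_norm nsQG.
elim: snH => [|H1 K sn IH sHK step] Hx.
  case/negP; rewrite (subset_trans _ (normal_sub nsQG)) // commg_subl cycle_subG.
  by rewrite (subsetP nQG) // (subsetP _ _ xz) // cycle_subG.
have Kx := subsetP sHK x Hx; move=> notRH.
have [sRK | ] := boolP ([~: Q, <[z]>] \subset K); last exact: IH.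
have Gx := subsetP (KHsn_sub sn) x Kx.
have nQz : <[z]> \subset 'N(Q).
  by rewrite cycle_subG (subsetP nQG) // (subsetP _ _ xz) // cycle_subG.
have coQz : coprime #|Q| #|<[z]>|.
  have pz : p.-elt z by apply: mem_p_elt px xz.
  by apply: (@pnat_coprime q) => //; apply: (pi_pnat pz); rewrite !inE.
have sRQ : [~: Q, <[z]>] \subset Q by rewrite commg_subl.
have defR := coprime_commGid nQz coQz (pgroup_sol qQ).
have sRQK : [~: Q, <[z]>] \subset [~: Q :&: K, <[z]>].
  by rewrite -{1}defR commSg // subsetI sRQ.
case: step => [nsHK | FK].
  case/negP: notRH; rewrite -defR (subset_trans (commgSS sRK (_ : <[z]> \subset H1))) //.
    by rewrite cycle_subG (subsetP _ _ xz) // cycle_subG.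
  by rewrite commg_subr normal_norm.
exists K, (gcore H1 K)%G; split=> //; first exact: gcore_normal.
  exact: KHsn_sub sn.
apply: contra notRH => sC; exact: subset_trans sRQK (subset_trans sC (gcore_sub _ _)).
Qed.

End ActionOnQGroups.

(** * Frattini extensions and saturation *)

(** Let [T] be a Hall [q^']-subgroup of [B], so that [B = M T]. The Frattini argument gives
    [G = M N_G(T)], whence [T] is normal in [G]. It then commutes with the coprime normal subgroup
    [M], and it contains every [q^']-element of [B]. *)
Lemma Frattini_p'core_cent (gT : finGroupType) (G M B : {group gT}) (q : nat) :
    solvable G -> M <| G -> q.-group M -> M \subset 'Phi(G) ->
    M \subset B -> B <| G -> B / M = 'O_q^'(G / M) ->
  forall x, x \in B -> q^'.-elt x -> x \in 'C(M).
Proof.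
move=> solG nsMG qM sMPhi sMB nsBG defBM x Bx q'x.
have [sBG nBG] := andP nsBG; have [sMG nMG] := andP nsMG.
have solB := solvableS sBG solG; have nMB := subset_trans sBG nMG.
have [T hallT] := Hall_exists q^' solB.
have sTB := pHall_sub hallT; have nMT := subset_trans sTB nMB.
have sBMT : B \subset M * T.
  have q'BM : q^'.-group (B / M) by rewrite defBM pcore_pgroup.
  by rewrite -quotientSK // (pHall_id (quotient_pHall nMT hallT) q'BM).
have nsTG : G \subset 'N(T).
  have defG := Hall_Frattini_arg solB nsBG hallT.
  suff /Phi_nongen : 'Phi(G) <*> 'N_G(T) = G.
    by rewrite genGid => <-; apply: subsetIr.
  apply/eqP; rewrite eqEsubset join_subG Phi_sub subsetIl /=.
  rewrite -{1}defG mul_subG ?joing_subr // (subset_trans sBMT) // mul_subG //.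
    exact: subset_trans sMPhi (joing_subl _ _).
  apply: subset_trans (joing_subr _ _).
  by rewrite subsetI normG (subset_trans sTB).
have Tx : x \in T.
  by rewrite (mem_normal_Hall hallT) // /normal sTB (subset_trans sBG).
apply: subsetP Tx; apply/commG1P/trivgP.
have coTM : coprime #|M| #|T| := pnat_coprime qM (pHall_pgroup hallT).
rewrite -(coprime_TIg coTM) setIC subsetI commg_subl commg_subr.
by rewrite (subset_trans sMG) // (subset_trans sTB) // (subset_trans sBG).
Qed.

Section Saturation.

Variables (F : gclass) (hF : homomorph F) (sF : hereditary F).

Lemma vstar_Frattini_qgroup (gT : finGroupType) (G M : {group gT}) (q : nat) :
    prime q -> solvable G -> M <| G -> q.-group M -> M \subset 'Phi(G) ->
  vstar F (G / M)%G -> vstar F G.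
Proof.
move=> q_pr solG nsMG qM sMPhi vGM x p Gx p_pr px.
have [sMG nMG] := andP nsMG.
have nMx : x \in 'N(M) := subsetP nMG x Gx.
have nMX : <[x]> \subset 'N(M) by rewrite cycle_subG.
have sXMX : <[x]> \subset M <*> <[x]> := joing_subr _ _.
apply: KHsn_trans (vstar_mul_KHsn hF nsMG vGM Gx p_pr px).
have [eq_pq | neq_pq] := eqVneq p q.
  apply: (@pgroup_KHsn _ _ _ _ p) => //.
  by rewrite /= norm_joinEr // pgroupM {1}eq_pq qM.
have [B defB sMB nsBG] := inv_quotientN nsMG (pcore_normal q^' (G / M)).
have q'x : q^'.-elt x by apply: (pi_pnat px); rewrite !inE.
have nMB := subset_trans (normal_sub nsBG) nMG.
pose Bb := 'O_q^'(G / M)%G; pose x1 := coset M x; pose x2 := coset Bb x1.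
pose S := (G / M / Bb)%G; pose Q := 'O_q(S)%G.
have Gx1 : x1 \in G / M by apply: mem_quotient.
have nBx1 : x1 \in 'N(Bb) by rewrite (subsetP (gFnorm _ _)).
have Sx2 : x2 \in S by apply: mem_quotient.
have px2 : p.-elt x2 by rewrite !morph_p_elt.
(* This power of [x] maps into ['O_q^'(G / M)], so it is a [q^']-element of [B]. *)
have cMx : x ^+ #[x2] \in 'C(M).
  have nMy : x ^+ #[x2] \in 'N(M) by rewrite groupX.
  apply: (Frattini_p'core_cent solG nsMG qM sMPhi sMB nsBG (esym defB)).
    have: coset M (x ^+ #[x2]) \in B / M.
      rewrite -defB morphX // -/x1; apply: coset_idr; rewrite ?groupX //.
      by rewrite morphX // expg_order.
    move/(mem_morphpre (f := coset_morphism M) nMy).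
    by rewrite quotientGK // (normalS sMB (normal_sub nsBG)).
  exact: mem_p_elt q'x (mem_cycle x _).
have [[|n] ox2] := p_natP px2.
  rewrite ox2 expg1 in cMx; apply: normal_KHsn.
  rewrite /normal sXMX join_subG normG andbT.
  by rewrite cents_norm // centsC cycle_subG.
pose z := x2 ^+ (p ^ n).
have xz : z \in <[x2]> by apply: mem_cycle.
have pz : p.-elt z by apply: mem_p_elt px2 xz.
have q'z : q^'.-elt z by apply: (pi_pnat pz); rewrite !inE.
have solS : solvable S by rewrite !quotient_sol.
have ntz : z != 1.
  by rewrite -order_dvdn ox2 gtnNdvd ?expn_gt0 ?prime_gt0 // ltn_exp2l // prime_gt1.
(* [S] has trivial [q^']-core, so [Q] is its Fitting subgroup and contains its centraliser; the
   nontrivial [q^']-element [z] therefore acts nontrivially on [Q]. *)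
have defFS : 'F(S) = Q by apply: Fitting_eq_pcore; apply: trivg_pcore_quotient.
have ncQz : z \notin 'C(Q).
  apply: contra ntz => cQz.
  have Qz : z \in Q.
    rewrite /= -defFS (subsetP (cent_sub_Fitting solS)) // defFS inE cQz.
    by rewrite groupX.
  have qz : q.-elt z := mem_p_elt (pcore_pgroup q S) Qz.
  by rewrite -order_eq1 (pnat_1 qz q'z).
have vS : vstar F S.
  exact: homomorph_quotient (vstar_homomorph hF) (pcore_normal _ _) vGM.
have snx2 := vS x2 p Sx2 p_pr px2.
have nsQS : Q <| S := pcore_normal q S.
have nQx2 : <[x2]> \subset 'N(Q) by rewrite cycle_subG (subsetP (gFnorm _ _)).
have nQz : <[z]> \subset 'N(Q) by rewrite (subset_trans _ nQx2) // cycle_subG.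
have notRx2 : ~~ ([~: Q, <[z]>] \subset <[x2]>).
  apply: contra ncQz => sRx2; rewrite -cycle_subG centsC.
  apply/commG1P/trivgP.
  have coQx : coprime #|Q| #|<[x2]>|.
    apply: (@pnat_coprime q); first exact: pcore_pgroup.
    by apply: (pi_pnat px2); rewrite !inE.
  by rewrite -(coprime_TIg coQx) subsetI sRx2 commg_subl nQz.
(* In [K / C] the image of [x2] acts on that of [Q :&: K] with order exactly [p ^ n.+1], while
   [x ^+ (p ^ n.+1)] centralises [M]. *)
have [K [C [nsCK sKS Kx2 FKC notRC]]] :=
  KHsn_nontrivial_section neq_pq snx2 (cycle_id x2) nsQS (pcore_pgroup q S) px2 xz notRx2.
have nCK := normal_norm nsCK.
have nCx2 : x2 \in 'N(C) := subsetP nCK x2 Kx2.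
have nCz : <[z]> \subset 'N(C) by rewrite cycle_subG groupX.
have nCQK : Q :&: K \subset 'N(C) by rewrite subIset // nCK orbT.
apply: (@coprime_action_KHsn _ hF sF p q p_pr q_pr neq_pq n _
  ((Q :&: K) / C)%G (K / C)%G (coset C x2)) => //.
- by rewrite morphimS // subsetIr.
- exact: mem_quotient.
- by rewrite quotient_pgroup // (pgroupS (subsetIl _ _)) ?pcore_pgroup.
- exact: morph_p_elt.
- rewrite -cycle_subG -quotient_cycle // quotient_norms // normsI //.
  by rewrite normsG // cycle_subG.
- by rewrite -morphX //= -ox2 expg_order morph1 group1.
- rewrite -morphX // -cycle_subG -quotient_cycle ?groupX //.
  by rewrite quotient_cents2 // commGC.
by rewrite -ox2.
Qed.

Lemma vstar_Frattini (gT : finGroupType) (G N : {group gT}) :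
    solvable G -> N <| G -> N \subset 'Phi(G) -> vstar F (G / N)%G -> vstar F G.
Proof.
have [r] := ubnP #|G|; elim: r gT G N => // r IH gT G N leGr solG nsNG sNPhi vGN.
have [N1 | ntN] := eqVneq (N : {set gT}) 1.
  apply: (homomorph_isog (vstar_homomorph hF) _ vGN).
  by rewrite (group_inj N1 : N = 1%G) isog_sym quotient1_isog.
have [M minM sMN] := minnormal_exists ntN (normal_norm nsNG).
have [/andP[ntM nMG] _] := mingroupP minM.
have sMG := subset_trans sMN (normal_sub nsNG).
have nsMG : M <| G by rewrite /normal sMG.
have [_ _ /is_abelemP[q q_pr abM]] := minnormal_solvable minM sMG solG.
apply: (vstar_Frattini_qgroup q_pr solG nsMG (abelem_pgroup abM)).
  exact: subset_trans sNPhi.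
apply: (IH _ _ (N / M)%G).
- by rewrite (leq_trans _ (leGr : #|G| <= r)) // ltn_quotient.
- exact: quotient_sol.
- exact: quotient_normal.
- by rewrite (subset_trans (morphimS _ sNPhi)) // morphimF.
apply: (homomorph_isog (vstar_homomorph hF) _ vGN).
by rewrite isog_sym third_isog.
Qed.

(** The chain may repeat [G], so its topmost proper member has to be picked out. *)
Lemma KHsn_proper (gT : finGroupType) (G H : {group gT}) :
    KH_subnormal F G H -> H \proper G ->
  exists K : {group gT},
    [/\ H \subset K, K \proper G & K <| G \/ F (G / gcore K G)%G].
Proof.
elim=> [|H1 K snK IH sHK step] prH; first by rewrite properxx in prH.
have [eqKG | neqKG] := eqVneq (K : {set gT}) G.
  by exists H1; rewrite -(group_inj eqKG) in prH step *.
have [|L [sKL prL stepL]] := IH; first by rewrite properEneq neqKG (KHsn_sub snK).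
by exists L; split=> //; apply: subset_trans sKL.
Qed.

(** Induction on the order: the topmost proper member [K] of a chain from a subgroup of prime order
    is soluble. Then [G / K] is soluble by induction, or the core quotient is soluble because it
    lies in [F]. *)
Lemma vstar_solvable (gT : finGroupType) (G : {group gT}) :
    (forall (hT : finGroupType) (H : {group hT}), F H -> solvable H) ->
  vstar F G -> solvable G.
Proof.
move=> solF; have [r] := ubnP #|G|; elim: r gT G => // r IH gT G leGr vG.
have [-> | ntG] := eqsVneq G 1; first exact: solvable1.
have p_pr : prime (pdiv #|G|) by rewrite pdiv_prime // cardG_gt1.
have [x Gx ox] := Cauchy p_pr (pdiv_dvd #|G|); set p := pdiv _ in p_pr ox.
have px : p.-elt x by rewrite /p_elt ox pnat_id.
have ntx : x != 1 by rewrite -order_gt1 ox prime_gt1.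
have sXG : <[x]> \subset G by rewrite cycle_subG.
have [<- | prX] := eqVproper sXG; first exact: abelian_sol (cycle_abelian x).
have [K [sXK prKG step]] := KHsn_proper (vG x p Gx p_pr px) prX.
have solK : solvable K.
  apply: IH (vstar_hereditary hF sF (proper_sub prKG) vG).
  exact: leq_trans (proper_card prKG) _.
case: step => [nsKG | /solF solGC].
  rewrite (series_sol nsKG) solK; apply: IH.
    rewrite (leq_trans _ (leGr : #|G| <= r)) // ltn_quotient ?normal_sub //.
    by apply: contraNneq ntx => K1; rewrite -cycle_eq1 -subG1 -K1.
  exact: homomorph_quotient (vstar_homomorph hF) nsKG vG.
rewrite (series_sol (gcore_normal (proper_sub prKG))) solGC andbT.
by rewrite (solvableS (gcore_sub _ _) solK).
Qed.

Lemma vstar_solubly_saturated (gT : finGroupType) (G : {group gT}) :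
  vstar F (G / 'Phi(sol_radical G))%G -> vstar F G.
Proof.
set R := sol_radical G => vG x p Gx p_pr px.
have nsRG : R <| G := sol_radical_normal G.
have solR : solvable R := sol_radical_solvable G.
have nsPG : 'Phi(R) <| G := char_normal_trans (Phi_char R) nsRG.
apply: KHsn_trans (vstar_mul_KHsn hF nsPG vG Gx p_pr px).
(* [S] is soluble and, as [R] is normal in it, ['Phi(R)] lies in ['Phi(S)]; so the soluble case
   applies to [S]. *)
pose S := (R <*> <[x]>)%G.
have nRx : <[x]> \subset 'N(R) by rewrite cycle_subG (subsetP (normal_norm nsRG)).
have sSG : S \subset G by rewrite join_subG normal_sub // cycle_subG.
have nsRS : R <| S by rewrite (normalS (joing_subl _ _) sSG).
have solS : solvable S.
  rewrite (series_sol nsRS) solR /= quotientYidl //.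
  by rewrite quotient_sol // abelian_sol ?cycle_abelian.
have sPS := PhiS_normal nsRS.
have nsPS : 'Phi(R) <| S.
  by apply: normalS sSG nsPG; apply: subset_trans (Phi_sub R) (joing_subl _ _).
have vS : vstar F S.
  apply: vstar_Frattini solS nsPS sPS _.
  by apply: vstar_hereditary vG => //; apply: morphimS.
have Sx : x \in S by rewrite -cycle_subG joing_subr.
have sPxS : 'Phi(R) <*> <[x]> \subset S.
  by rewrite join_subG (normal_sub nsPS) cycle_subG.
have := KHsn_setI hF sF sPxS (vS x p Sx p_pr px).
by congr (KH_subnormal F _ _); apply: group_inj; apply/setIidPl; apply: joing_subr.
Qed.

End Saturation.

Theorem theorem2 (F : gclass) :
  homomorph F -> hereditary F ->
  solubly_saturated_formation (vstar F) /\
  ((forall (gT : finGroupType) (G : {group gT}), F gT G -> solvable G) ->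
   saturated_formation (vstar F)).
Proof.
move=> hF sF.
have formF : formation (vstar F).
  by split; [apply: vstar_homomorph | apply: vstar_subdirect].
split; first by split=> // gT G; apply: vstar_solubly_saturated.
move=> solF; split=> // gT G vG.
have solG : solvable G by apply/solvable_Phi_quotient/(vstar_solvable hF sF solF vG).
exact: (vstar_Frattini hF sF solG (Phi_normal G) (subxx _) vG).
Qed.
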